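(* Let $f_1,\dots,f_m:\mathbb{R}^n\to\mathbb{R}$ be continuously differentiable, let $f=\frac1m\sum_{k=1}^mf_k$, and for $\alpha>0$ let $$G_\alpha(\mathbf{x})=\frac{\alpha}{m}\sum_{k=1}^mf_k(x_k)+\frac12\mathbf{x}^T(I-W\otimes I_n)\mathbf{x},\qquad\mathbf{x}=(x_1,\dots,x_m)\in\mathbb{R}^{nm}.$$ If $G_\alpha$ is $\mu$-strongly convex for some $\alpha>0$ (with $\mu>0$), then $f$ is $\frac{\mu}{\alpha}$-strongly convex.
   Context: $W=\{w_{ij}\}_{1\le i,j\le m}$ is a matrix with nonnegative entries associated with an undirected connected graph $\mathcal{G}=(\mathcal{V},\mathcal{E})$ on $\mathcal{V}=\{1,\dots,m\}$: for $i\neq j$, $w_{ij}>0$ if and only if $\{i,j\}\in\mathcal{E}$; $w_{ii}>0$ for all $i$; and $W$ is doubly stochastic ($W\mathbf{1}=\mathbf{1}$, $\mathbf{1}^TW=\mathbf{1}^T$). $I_n$ is the $n\times n$ identity, $I$ is the $nm\times nm$ identity, and $\mathbf{x}^T(I-W\otimes I_n)\mathbf{x}=\sum_{k}\|x_k\|^2-\sum_{k,j}w_{kj}x_k^Tx_j$. A differentiable function $g$ is $\mu$-strongly convex ($\mu>0$) if $g(y)\ge g(x)+\langle\nabla g(x),y-x\rangle+\frac{\mu}{2}\|y-x\|^2$ for all $x,y$. *)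

(* Defs.v *)
From HB Require Import structures.
From mathcomp Require Import all_boot all_order all_algebra.
From mathcomp Require Import mxtens.
From mathcomp Require Import all_classical all_reals all_analysis.
Set Implicit Arguments.
Unset Strict Implicit.
Unset Printing Implicit Defensive.
Import Order.TTheory GRing.Theory Num.Theory.
Import numFieldNormedType.Exports.
Local Open Scope ring_scope.

Section Euclidean.
Variables (R : realType) (n : nat).
Implicit Types x y : 'cV[R]_n.

Definition dot x y : R := (x^T *m y) 0 0.

(* The library norm on matrices is the sup norm. The Euclidean norm is used
   in the strong convexity inequality; the two norms give the same topology,
   hence the same notions of continuity and differentiability. *)
Definition enorm x : R := Num.sqrt (dot x x).

Implicit Type g : 'cV[R]_n -> R.

Definition grad g x : 'cV[R]_n := \col_i 'D_(delta_mx i 0) g x.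

Definition continuously_differentiable g : Prop :=
  (forall x, differentiable g x) /\ continuous (grad g).

Definition strongly_convex (mu : R) g : Prop :=
  [/\ 0 < mu,
      forall x, differentiable g x &
      forall x y,
        g x + dot (grad g x) (y - x) + mu / 2 * enorm (y - x) ^+ 2 <= g y].

End Euclidean.

(* The edge set is the symmetric relation E; E is not required to be
   irreflexive because only pairs of distinct vertices are ever used. *)
Definition undirected_connected (m : nat) (E : rel 'I_m) : Prop :=
  symmetric E /\ forall i j, connect E i j.

Definition graph_matrix (R : realType) (m : nat) (E : rel 'I_m)
    (W : 'M[R]_m) : Prop :=
  [/\ forall i j, 0 <= W i j,
      forall i j, i != j -> (0 < W i j) = E i j &
      forall i, 0 < W i i].

Definition doubly_stochastic (R : realType) (m : nat) (W : 'M[R]_m) : Prop :=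
  let one : 'cV[R]_m := const_mx 1 in W *m one = one /\ one^T *m W = one^T.

(* Block x_k of x = (x_1, ..., x_m); mxtens_index is the row-major pairing
   used by the Kronecker product *t, so that W *t 1%:M acts by blocks, see
   quad_formE. *)
Definition block (R : realType) (m n : nat) (x : 'cV[R]_(m * n)) (k : 'I_m) :
    'cV[R]_n :=
  \col_i x (mxtens_index (k, i)) 0.

Definition average (R : realType) (m n : nat) (f : 'I_m -> 'cV[R]_n -> R)
    (x : 'cV[R]_n) : R :=
  m%:R^-1 * \sum_k f k x.

Definition quad_form (R : realType) (m n : nat) (W : 'M[R]_m)
    (x : 'cV[R]_(m * n)) : R :=
  (x^T *m (1%:M - W *t (1%:M : 'M[R]_n)) *m x) 0 0.

Definition G (R : realType) (m n : nat) (W : 'M[R]_m)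
    (f : 'I_m -> 'cV[R]_n -> R) (alpha : R) (x : 'cV[R]_(m * n)) : R :=
  alpha / m%:R * \sum_k f k (block x k) + 2^-1 * quad_form W x.

Lemma quad_formE (R : realType) (m n : nat) (W : 'M[R]_m)
    (x : 'cV[R]_(m * n)) :
  quad_form W x =
    \sum_k enorm (block x k) ^+ 2
    - \sum_k \sum_j W k j * dot (block x k) (block x j).
Proof.
have reidx (F : 'I_(m * n) -> R) :
    \sum_p F p = \sum_k \sum_i F (mxtens_index (k, i)).
  rewrite pair_big /= (reindex (@mxtens_index m n)) /=; last first.
    exists (@mxtens_unindex m n) => p _; [exact: mxtens_indexK|].
    exact: mxtens_unindexK.
  by apply: eq_bigr => -[k i] _.
have dotE p (u v : 'cV[R]_p) : dot u v = \sum_i u i 0 * v i 0.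
  by rewrite /dot mxE; apply: eq_bigr => i _; rewrite mxE.
have enormE p (u : 'cV[R]_p) : enorm u ^+ 2 = dot u u.
  rewrite sqr_sqrtr // dotE; apply: sumr_ge0 => i _.
  by rewrite -expr2 sqr_ge0.
have Wx k i : ((W *t (1%:M : 'M[R]_n)) *m x) (mxtens_index (k, i)) 0 =
    \sum_j W k j * block x j i 0.
  rewrite mxE reidx; apply: eq_bigr => j _.
  rewrite (bigD1 i) //= big1 ?addr0 => [|l li].
    by rewrite tensmxE !mxE eqxx mulr1.
  by rewrite tensmxE !mxE eq_sym (negPf li) mulr0 mul0r.
rewrite /quad_form -mulmxA mulmxBl mul1mx mulmxBr !mxE; congr (_ - _).
  rewrite reidx; apply: eq_bigr => k _; rewrite enormE dotE.
  by apply: eq_bigr => i _; rewrite !mxE.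
rewrite reidx; apply: eq_bigr => k _.
under eq_bigr do rewrite Wx mulr_sumr.
rewrite exchange_big; apply: eq_bigr => j _.
rewrite dotE mulr_sumr; apply: eq_bigr => i _.
by rewrite !mxE mulrCA.
Qed.

(* Main.v *)
Require Import Defs.
From HB Require Import structures.
From mathcomp Require Import all_boot all_order all_algebra.
From mathcomp Require Import mxtens ring.
From mathcomp Require Import all_classical all_reals all_analysis.
Import Order.TTheory GRing.Theory Num.Theory.
Import numFieldNormedType.Exports.
Local Open Scope ring_scope.

(** On the consensus subspace [x_1 = ... = x_m] the quadratic form vanishes
because the rows of [W] sum to 1, so [G_alpha] restricted to it is
[alpha * f]. The consensus embedding multiplies squared norms by [m >= 1], so
strong convexity of [G_alpha] even makes [f] strongly convex with constant
[m * mu / alpha]. *)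

Lemma dotE (R : realType) (n : nat) (x y : 'cV[R]_n) :
  dot x y = \sum_i x i 0 * y i 0.
Proof. by rewrite /dot mxE; apply: eq_bigr => i _; rewrite mxE. Qed.

Lemma dot_ge0 (R : realType) (n : nat) (x : 'cV[R]_n) : 0 <= dot x x.
Proof. by rewrite dotE sumr_ge0 // => i _; rewrite -expr2 sqr_ge0. Qed.

Lemma enorm_sqr (R : realType) (n : nat) (x : 'cV[R]_n) :
  enorm x ^+ 2 = dot x x.
Proof. by rewrite sqr_sqrtr // dot_ge0. Qed.

Lemma dot_block (R : realType) (m n : nat) (x y : 'cV[R]_(m * n)) :
  dot x y = \sum_k dot (block x k) (block y k).
Proof.
rewrite dotE; under [RHS]eq_bigr do rewrite dotE.
rewrite pair_big /= (reindex (@mxtens_index m n)) /=; last first.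
  exists (@mxtens_unindex m n) => p _; first exact: mxtens_indexK.
  exact: mxtens_unindexK.
by apply: eq_bigr => -[k i] _; rewrite !mxE.
Qed.

(** Differentiability makes the derivative linear in its direction, so [v] can be expanded in the
    standard basis, whose directional derivatives are the entries of [grad g x]. Gradients on
    ['cV[R]_(m * n)] and on ['cV[R]_n] can then be compared through directional derivatives
    alone. *)
Lemma dot_grad (R : realType) (n : nat) (g : 'cV[R]_n -> R) (x v : 'cV[R]_n) :
  differentiable g x -> dot (grad g x) v = 'D_v g x.
Proof.
move=> dg; rewrite dotE deriveE // [in RHS](matrix_sum_delta v) linear_sum.
apply: eq_bigr => i _.
by rewrite big_ord1 linearZ /= mxE deriveE // mulrC.
Qed.

Lemma differentiable_average (R : realType) (m n : nat)
    (f : 'I_m -> 'cV[R]_n -> R) (x : 'cV[R]_n) :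
  (forall k, differentiable (f k) x) -> differentiable (average f) x.
Proof.
move=> df; have -> : average f = m%:R^-1 *: \sum_k f k.
  by apply/funext => y; rewrite /average fctE fct_sumE.
by apply: differentiableZ; apply: differentiable_sum.
Qed.

(** This is the Kronecker product of the all-ones vector with [x], written with the same pairing of
    indices as [block]. *)
Definition consensus (R : realType) (m n : nat) (x : 'cV[R]_n) :
    'cV[R]_(m * n) :=
  \col_p x (mxtens_unindex p).2 0.

Arguments consensus {R} m {n} x.

Section Consensus.
Context {R : realType} {m n : nat}.
Implicit Types (x y v : 'cV[R]_n) (W : 'M[R]_m).

Lemma block_consensus x k : block (consensus m x) k = x.
Proof. by apply/colP => i; rewrite !mxE mxtens_indexK. Qed.

Lemma consensusB x y : consensus m (x - y) = consensus m x - consensus m y.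
Proof. by apply/colP => p; rewrite !mxE. Qed.

(** The argument [h *: v + x] has the shape found in the difference quotient behind ['D_v]. *)
Lemma consensusDZ (h : R) v x :
  consensus m (h *: v + x) = h *: consensus m v + consensus m x.
Proof. by apply/colP => p; rewrite !mxE. Qed.

Lemma enorm_consensus x : enorm (consensus m x) ^+ 2 = m%:R * enorm x ^+ 2.
Proof.
rewrite !enorm_sqr dot_block; under eq_bigr do rewrite block_consensus.
by rewrite sumr_const card_ord mulr_natl.
Qed.

Lemma quad_form_consensus W x :
  doubly_stochastic W -> quad_form W (consensus m x) = 0.
Proof.
move=> [W1 _]; rewrite quad_formE; apply/eqP; rewrite subr_eq0; apply/eqP.
apply: eq_bigr => k _; under [RHS]eq_bigr do rewrite !block_consensus.
(* With [dot x x] factored out, what remains is that row [k] of [W] sums to 1. *)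
rewrite block_consensus enorm_sqr -mulr_suml.
have /colP/(_ k) := W1; rewrite !mxE.
by under eq_bigr do rewrite mxE mulr1; move=> ->; rewrite mul1r.
Qed.

Lemma G_consensus W (f : 'I_m -> 'cV[R]_n -> R) (alpha : R) x :
  doubly_stochastic W ->
  G W f alpha (consensus m x) = alpha * average f x.
Proof.
move=> dsW; rewrite /G quad_form_consensus // mulr0 addr0 /average mulrA.
by congr (_ * _); apply: eq_bigr => k _; rewrite block_consensus.
Qed.

(** By linearity of [consensus] both sides are limits of the same difference quotient, so no chain
    rule is involved. *)
Lemma derive_consensus (g : 'cV[R]_(m * n) -> R) x v :
  'D_(consensus m v) g (consensus m x) = 'D_v (g \o consensus m) x.
Proof.
by rewrite /derive /=; under [in RHS]eq_fun do rewrite consensusDZ.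
Qed.

End Consensus.

Theorem theorem2p2 (R : realType) (m n : nat) (E : rel 'I_m) (W : 'M[R]_m)
    (f : 'I_m -> 'cV[R]_n -> R) (alpha mu : R) :
  (0 < m)%N ->
  undirected_connected E ->
  graph_matrix E W ->
  doubly_stochastic W ->
  (forall k, continuously_differentiable (f k)) ->
  0 < alpha ->
  0 < mu ->
  strongly_convex mu (G W f alpha) ->
  strongly_convex (mu / alpha) (average f).
Proof.
move=> m0 _ _ dsW cdf a0 mu0 [_ dG scG].
have dave x : differentiable (average f) x.
  by apply: differentiable_average => k; case: (cdf k) => + _; apply.
split=> [|//|x y]; first exact: divr_gt0.
have := scG (consensus m x) (consensus m y).
rewrite -consensusB dot_grad // derive_consensus enorm_consensus !G_consensus //.
have -> : G W f alpha \o consensus m = alpha *: average f.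
  by apply/funext => z; rewrite /= G_consensus.
rewrite deriveZ; last exact: diff_derivable.
rewrite -dot_grad // => scxy.
(* After scaling by [alpha], the value and gradient terms agree on both sides and only the quadratic
   terms are left to compare. *)
rewrite -(ler_pM2l a0); apply: le_trans scxy; rewrite !mulrDr lerD2l.
have -> : alpha * (mu / alpha / 2 * enorm (y - x) ^+ 2) =
          mu / 2 * enorm (y - x) ^+ 2 by field; rewrite gt_eqF.
(* The factor [m%:R] from [enorm_consensus] is at least 1 and is dropped here. *)
rewrite ler_pM2l ?divr_gt0 // ler_peMl ?sqr_ge0 //.
by rewrite ler1n.
Qed.
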